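(* Let $S:[0,+\infty)\to[0,+\infty]$ be an increasing function, let $\lambda>0$, and let $n\ge 2$ be an integer. Suppose that $$\int_0^1 S(tx)(1-x^2)^{n-2}x\,dx\le t^{\lambda}\qquad\text{for all } t\in[0,+\infty).$$ Then $$\int_0^{+\infty}S(t)\,\frac{t^{2\lambda-1}}{(1+t^{2\lambda})^2}\,dt\ \le\ \frac{\pi}{2}\cdot\frac{n-1}{\lambda}\left(1+\frac12\cdot\frac{\lambda}{n-1}\right)^{n-1}\left(1+2\cdot\frac{n-1}{\lambda}\right)^{\lambda/2}.$$
   Context: ''Increasing'' is meant in the non-strict sense: $x_1\le x_2$ implies $S(x_1)\le S(x_2)$. *)

(* Defs.v *)
From HB Require Import structures.
From mathcomp Require Export all_boot all_order all_algebra.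
From mathcomp Require Export all_classical all_reals all_analysis.

(* Main.v *)
(* By monotonicity, keeping only [a, 1] in the hypothesis at t gives
   S(a t) (1 - a^2)^(n-1) / (2 (n-1)) <= t^lambda for 0 <= a < 1.  Choosing the a
   that maximises a^lambda (1 - a^2)^(n-1), this reads S(s) <= C s^lambda with
   C = 2 (n-1) (1 + lambda / (2 (n-1)))^(n-1) (1 + 2 (n-1) / lambda)^(lambda/2).
   The substitution u = t^lambda turns the integral of t^lambda against the weight
   into 1/lambda times the integral of u^2 / (1 + u^2)^2 over [0, +oo[, that is
   pi / (4 lambda). *)
Require Import Defs.
From mathcomp Require Import measurable_realfun ring.
Import Order.TTheory GRing.Theory Num.Theory.
Import numFieldNormedType.Exports.
Local Open Scope classical_set_scope.
Local Open Scope ring_scope.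

(** * Comparison of integrals, and the averaging weight *)

(* [ge0_le_integral] would require S to be measurable, but S is only known to be
   monotone, and only on [0, +oo[. *)
Lemma le_integral_nonneg d (T : measurableType d) (R : realType)
    (mu : {measure set T -> \bar R}) (D : set T) (f g : T -> \bar R) :
  (forall x, D x -> (0 <= f x)%E) -> (forall x, D x -> (f x <= g x)%E) ->
  (\int[mu]_(x in D) f x <= \int[mu]_(x in D) g x)%E.
Proof.
move=> f0 fg.
have g0 x : D x -> (0 <= g x)%E by move=> Dx; exact: le_trans (f0 _ Dx) (fg _ Dx).
rewrite !ge0_integralE//; apply: ereal_sup_le => _ [h hf <-].
exists h => // x; apply: (le_trans (hf x)).
by rewrite /patch; case: ifPn => // /set_mem; exact: fg.
Qed.

(** The integrand has primitive -(1 - x^2)^(k+1) / (2 (k+1)), which vanishes at 1. *)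
Lemma integral_onemsqrX (R : realType) (a : R) (k : nat) : a < 1 ->
  (\int[@lebesgue_measure R]_(x in `[a, 1%R]) ((1 - x ^+ 2) ^+ k * x)%:E
    = ((1 - a ^+ 2) ^+ k.+1 / (2 * k.+1%:R))%:E)%E.
Proof.
move=> a1.
pose F : R -> R :=
  - ((cst 1 - (id : R -> R) ^+ 2) ^+ k.+1 * cst (2 * k.+1%:R)^-1).
have FE x : F x = - ((1 - x ^+ 2) ^+ k.+1 / (2 * k.+1%:R)) by rewrite /F !fctE.
have dF (x : R) : is_derive x 1 F ((1 - x ^+ 2) ^+ k * x).
  rewrite /F; apply: is_derive_eq; rewrite !fctE scaler0 /GRing.scale/=.
  by field; rewrite lt0r_neq0.
have cF : continuous F.
  by move=> x; apply: differentiable_continuous; exact/derivable1_diffP.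
rewrite (@continuous_FTC2 _ _ F)//.
- by rewrite -EFinB !FE expr1n subrr expr0n /= mul0r oppr0 sub0r opprK.
- apply: continuous_subspaceT => x.
  apply: cvgM; last exact: cvg_id.
  apply: (@continuous_comp _ _ _ (fun y : R => 1 - y ^+ 2) (fun y => y ^+ k));
    last exact: exprn_continuous.
  by apply: cvgB; [exact: cvg_cst | exact: exprn_continuous].
- split; first by move=> x _; exact: ex_derive.
  + by apply: cvg_at_right_filter; exact: cF.
  + by apply: cvg_at_left_filter; exact: cF.
- by move=> x _; rewrite derive1E derive_val.
Qed.

(** * The primitive of s^2 / (1 + s^2)^2 *)

(** Obtained by integrating s * (s / (1 + s^2)^2) by parts, normalised to vanish at 0. *)
Definition atan_primitive (R : realType) (s : R) : R :=
  (atan s - s / (1 + s ^+ 2)) / 2.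

Lemma oneDsqr_gt0 (R : realType) (s : R) : 0 < 1 + s ^+ 2.
Proof. by rewrite ltr_pwDl// sqr_ge0. Qed.

Lemma is_derive_atan_primitive (R : realType) (s : R) :
  is_derive s 1 (@atan_primitive R) (s ^+ 2 / (1 + s ^+ 2) ^+ 2).
Proof.
have s0 : 1 + s ^+ 2 != 0 := lt0r_neq0 (oneDsqr_gt0 R s).
have dV := @is_deriveV R (cst 1 + (id : R -> R) ^+ 2) s 1 _ s0 _.
have -> : @atan_primitive R = (atan
   - (id : R -> R) * (fun y : R => ((cst 1 + (id : R -> R) ^+ 2) y)^-1))
   * cst (2^-1) by [].
apply: is_derive_eq; rewrite !fctE scaler0 /GRing.scale/=.
by field.
Qed.

Lemma continuous_atan_primitive (R : realType) : continuous (@atan_primitive R).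
Proof.
move=> s; apply: differentiable_continuous; apply/derivable1_diffP.
by apply: ex_derive; exact: is_derive_atan_primitive.
Qed.

(** The sign allows the boundary term at the lower limit of integration to be dropped. *)
Lemma atan_primitive_ge0 (R : realType) (s : R) : 0 <= s -> 0 <= atan_primitive R s.
Proof.
move=> s0; have -> : 0 = atan_primitive R 0.
  by rewrite /atan_primitive atan0 mul0r subr0 mul0r.
have dG (x : R) := is_derive_atan_primitive R x.
apply: (@ger0_derive1_le_cc R (@atan_primitive R) 0 s) => //.
- by move=> x _; rewrite derive1E derive_val divr_ge0// ?sqr_ge0.
- by apply: continuous_subspaceT; exact: continuous_atan_primitive.
- by rewrite in_itv/= lexx.
- by rewrite in_itv/= lexx s0.
Qed.

Lemma cvgy_atan_primitive (R : realType) :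
  atan_primitive R s @[s --> +oo] --> pi / 4.
Proof.
have -> : pi / 4 = (pi / 2 - 0) / 2 :> R by field.
apply: cvgM; last exact: cvg_cst.
apply: cvgB; first exact: cvgy_atan.
apply: (@squeeze_cvgr _ _ _ _ (cst 0) (fun s : R => s^-1)).
- near=> s.
  have s0 : 0 < s by near: s; exact: nbhs_pinfty_gt.
  rewrite /= divr_ge0 ?(ltW s0) ?(ltW (oneDsqr_gt0 R s))//=.
  rewrite ler_pdivrMr ?oneDsqr_gt0//.
  rewrite mulrDr mulr1 expr2 mulKf ?lt0r_neq0//.
  by rewrite lerDr invr_ge0 ltW.
- exact: cvg_cst.
- apply/gtr0_cvgV0; last exact: cvg_id.
  exact: nbhs_pinfty_gt.
Unshelve. all: by end_near. Qed.

(** * The substitution u = t^p *)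

Lemma cvgy_powR (R : realType) (p : R) : 0 < p -> x `^ p @[x --> +oo] --> +oo.
Proof.
move=> p0; apply/cvgryPge => A.
near=> x.
have x1 : 1 <= x by near: x; exact: nbhs_pinfty_ge.
(* The p-th power of this threshold is |A|; the absolute value keeps the base nonnegative when A is
   negative. *)
have xA : `|A| `^ p^-1 <= x by near: x; exact: nbhs_pinfty_ge.
rewrite (le_trans (ler_norm A))//.
rewrite -[leLHS]powRr1// -(@mulVf _ p) ?gt_eqF// powRrM.
by rewrite ge0_ler_powR ?(ltW p0) ?nnegrE ?powR_ge0 ?(le_trans ler01 x1).
Unshelve. all: by end_near. Qed.

(** The integrand left once S t is replaced by t^p. For t > 0 and u = t^p it is u^2 / (1 + u^2)^2 *
    u' / p. *)
Definition weighted_powR (R : realType) (p t : R) : R :=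
  t `^ p * (t `^ (2 * p - 1) / (1 + t `^ (2 * p)) ^+ 2).

Lemma powR2 (R : realType) (p t : R) : t `^ (2 * p) = (t `^ p) ^+ 2.
Proof. by rewrite -powR_mulrn ?powR_ge0// -powRrM mulrC. Qed.

Lemma weighted_powR_ge0 (R : realType) (p t : R) : 0 <= weighted_powR R p t.
Proof.
by rewrite /weighted_powR mulr_ge0 ?powR_ge0// divr_ge0 ?powR_ge0// sqr_ge0.
Qed.

Lemma measurable_weighted_powR (R : realType) (p : R) :
  measurable_fun setT (@weighted_powR R p).
Proof.
apply: measurable_funM; first exact: measurable_powR.
apply: measurable_funM; first exact: measurable_powR.
(* The inverse square becomes a real power with a negative exponent, so [measurable_powR] covers
   it. *)
under eq_fun => t do rewrite -powR_invn ?addr_ge0 ?powR_ge0//.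
apply: (measurableT_comp (measurable_powR _)).
by apply: measurable_funD => //; exact: measurable_powR.
Qed.

Lemma is_derive_atan_primitive_powR (R : realType) (p t : R) : 0 < p -> 0 < t ->
  is_derive t 1 (fun x : R => atan_primitive R (x `^ p) / p) (weighted_powR R p t).
Proof.
move=> p0 t0.
have dG := is_derive_atan_primitive R (t `^ p).
have dP := is_derive1_powR p t0.
have dC := @is_derive1_comp R (@atan_primitive R) (@powR R ^~ p) t _ _ dG dP.
have -> : (fun x : R => atan_primitive R (x `^ p) / p) =
    (@atan_primitive R \o (@powR R ^~ p)) * cst p^-1 by [].
apply: is_derive_eq; rewrite /= scaler0 add0r /GRing.scale/= /weighted_powR.
rewrite powR2.
(* The factor t^(p - 1) comes from the derivative of t^p; what remains is a rational identity in
   these two powers. *)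
have -> : t `^ (2 * p - 1) = t `^ p * t `^ (p - 1).
  by rewrite -powRD ?(gt_eqF t0) ?implybT//; congr (_ `^ _); ring.
have := lt0r_neq0 (oneDsqr_gt0 R (t `^ p)); move: (t `^ p) (t `^ (p - 1)) => u v u0.
by field; rewrite u0 gt_eqF.
Qed.

Lemma integral_weighted_powR_itvcy (R : realType) (p e : R) : 0 < p -> 0 < e ->
  (\int[@lebesgue_measure R]_(t in `[e, +oo[) (weighted_powR R p t)%:E
    = (pi / 4 / p)%:E - (atan_primitive R (e `^ p) / p)%:E)%E.
Proof.
move=> p0 e0.
have cp (q x : R) : 0 < x -> {for x, continuous (@powR R ^~ q)}.
  move=> x0; apply: differentiable_continuous; apply/derivable1_diffP.
  by apply: derivable_powR; rewrite in_itv/= x0.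
rewrite (@ge0_continuous_FTC2y R _ (fun x : R => atan_primitive R (x `^ p) / p)
  _ (pi / 4 / p))//.
- by move=> x _; exact: weighted_powR_ge0.
- apply: continuous_in_subspaceT => x /set_mem/=; rewrite in_itv/= andbT => ex.
  have x0 : 0 < x := lt_le_trans e0 ex.
  apply: cvgM; first exact: cp.
  apply: cvgM; first exact: cp.
  apply: cvgV.
    by rewrite powR2 expf_neq0// lt0r_neq0// oneDsqr_gt0.
  apply: (@continuous_comp _ _ _ (fun y : R => 1 + y `^ (2 * p)) (fun y => y ^+ 2));
    last exact: exprn_continuous.
  apply: cvgD; [exact: cvg_cst | exact: cp].
- apply: cvgM; last exact: cvg_cst.
  apply: cvg_comp; last exact: cvgy_atan_primitive.
  exact: cvgy_powR.
- move=> x ex; apply: ex_derive.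
  by apply: is_derive_atan_primitive_powR => //; exact: lt_trans ex.
- apply: cvg_at_right_filter.
  have [+ _] := is_derive_atan_primitive_powR R p e p0 e0.
  by move=> /derivable1_diffP/differentiable_continuous.
- move=> x; rewrite in_itv/= andbT => ex.
  have x0 := lt_trans e0 ex.
  have dx := is_derive_atan_primitive_powR R p x p0 x0.
  by rewrite derive1E derive_val.
Qed.

(* For 3 p < 1 the integrand blows up at 0, so the fundamental theorem of calculus
   is applied on [1/(i+1), +oo[ only. *)
Lemma integral_weighted_powR_le (R : realType) (p : R) : 0 < p ->
  (\int[@lebesgue_measure R]_(t in `[0%R, +oo[) (weighted_powR R p t)%:E
    <= (pi / 4 / p)%:E)%E.
Proof.
move=> p0.
have mw (D : set R) : measurable_fun D (EFin \o @weighted_powR R p).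
  apply/measurable_EFinP; apply: measurable_funTS.
  exact: measurable_weighted_powR.
rewrite -integral_itv_obnd_cbnd; last exact: mw.
pose F (i : nat) : set R := `[i.+1%:R^-1, +oo[%classic.
have -> : `]0%R, +oo[%classic = \bigcup_i F i.
  apply/seteqP; split => x /=.
    (* With i the integer part of 1/x, 1/x < i + 1, so x lies in [F i]. *)
    rewrite in_itv/= andbT => x0; exists (Num.truncn x^-1) => //=.
    rewrite /F/= in_itv/= andbT invf_ple ?posrE// ltW//.
    exact: truncnS_gt.
  by move=> [i _]; rewrite /F/= !in_itv/= !andbT; apply: lt_le_trans.
(* Monotone convergence along the increasing sets [F i]; each integral is pi / (4 p) minus a
   nonnegative boundary value. *)
have cF : (\int[@lebesgue_measure R]_(x in F i) (weighted_powR R p x)%:E)%E @[i --> \oo]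
    --> (\int[@lebesgue_measure R]_(x in \bigcup_i F i) (weighted_powR R p x)%:E)%E.
  apply: ge0_nondecreasing_set_cvg_integral.
  - move=> i j ij; apply/subsetPset => x; rewrite /F/= !in_itv/= !andbT.
    by apply: le_trans; rewrite lef_pV2 ?posrE// ler_nat.
  - by move=> i; exact: measurable_itv.
  - by move=> i; exact: mw.
  - by move=> i x _; rewrite lee_fin weighted_powR_ge0.
rewrite -(cvg_lim _ cF)//; apply: lime_le.
  by apply/cvg_ex; eexists; exact: cF.
apply: nearW => i; rewrite integral_weighted_powR_itvcy// -EFinB lee_fin.
by rewrite lerBlDr lerDl divr_ge0 ?atan_primitive_ge0 ?powR_ge0// ltW.
Qed.

(** * The growth bound on S and the conclusion *)

(** The constant S (t a) goes inside the integral of the weight over [a, 1]. Both integrands are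
    then extended by zero and compared pointwise: monotonicity of S settles [a, 1], nonnegativity
    the rest. *)
Lemma growth_from_averages (R : realType) (S : R -> \bar R) (k : nat)
  (a t : R) (M : \bar R)
  (S_ge0 : forall x : R, 0 <= x -> (0 <= S x)%E)
  (S_incr : forall x1 x2 : R, 0 <= x1 -> x1 <= x2 -> (S x1 <= S x2)%E) :
  0 <= a -> a < 1 -> 0 <= t ->
  (\int[@lebesgue_measure R]_(x in `[0%R, 1%R])
        (S (t * x)%R * ((1 - x ^+ 2) ^+ k * x)%R%:E) <= M)%E ->
  (S (t * a)%R * ((1 - a ^+ 2) ^+ k.+1 / (2 * k.+1%:R))%:E <= M)%E.
Proof.
move=> a0 a1 t0; apply: le_trans.
have w0 (x : R) : 0 <= x -> x <= 1 -> 0 <= (1 - x ^+ 2) ^+ k * x.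
  by move=> x0 x1; rewrite mulr_ge0// exprn_ge0// subr_ge0 expr_le1.
rewrite -integral_onemsqrX// -ge0_integralZl//; first last.
- by rewrite S_ge0// mulr_ge0.
- move=> x /=; rewrite in_itv/= => /andP[ax x1].
  by rewrite lee_fin w0// (le_trans a0).
- apply/measurable_EFinP; apply: measurable_funTS.
  by apply: measurable_funM => //; apply: measurable_funX; exact: measurable_funB.
rewrite integral_mkcond [leRHS]integral_mkcond.
apply: le_integral_nonneg => x _; rewrite /patch.
  case: ifPn => // /set_mem /=; rewrite in_itv/= => /andP[ax x1].
  by rewrite mule_ge0 ?S_ge0 ?mulr_ge0// lee_fin w0// (le_trans a0).
case: ifPn => [/set_mem /=|_].
  rewrite in_itv/= => /andP[ax x1].
  have x0 : 0 <= x := le_trans a0 ax.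
  rewrite ifT; last by apply/mem_set; rewrite /= in_itv/= x0.
  apply: lee_wpmul2r; first by rewrite lee_fin w0.
  by apply: S_incr; [rewrite mulr_ge0 | rewrite ler_wpM2l].
case: ifPn => // /set_mem /=; rewrite in_itv/= => /andP[x0 x1].
by rewrite mule_ge0 ?S_ge0 ?mulr_ge0// lee_fin w0.
Qed.

Theorem mainTheorem3 (R : realType) (S : R -> \bar R) (lambda : R) (n : nat)
  (S_ge0 : forall x : R, 0 <= x -> (0 <= S x)%E)
  (S_incr : forall x1 x2 : R, 0 <= x1 -> x1 <= x2 -> (S x1 <= S x2)%E)
  (lambda_gt0 : 0 < lambda)
  (n_ge2 : (2 <= n)%N)
  (S_bound : forall t : R, 0 <= t ->
    (\int[@lebesgue_measure R]_(x in `[0%R, 1%R])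
        (S (t * x)%R * ((1 - x ^+ 2) ^+ (n - 2) * x)%R%:E)
      <= (t `^ lambda)%R%:E)%E) :
  (\int[@lebesgue_measure R]_(t in `[0%R, +oo[)
      (S t * (t `^ (2 * lambda - 1) / (1 + t `^ (2 * lambda)) ^+ 2)%R%:E)
    <= (pi / 2 * ((n - 1)%:R / lambda)
        * (1 + 1 / 2 * (lambda / (n - 1)%:R)) ^+ (n - 1)
        * (1 + 2 * ((n - 1)%:R / lambda)) `^ (lambda / 2))%R%:E)%E.
Proof.
case: n n_ge2 S_bound => [|[|k]]// _; rewrite subn1 subn2 /= => S_bound.
pose m : R := k.+1%:R; rewrite -/m.
have m0 : 0 < m by rewrite ltr0n.
(* The maximiser a of a^lambda (1 - a^2)^m satisfies a^2 = lambda / (lambda + 2 m). *)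
pose q : R := 1 + 2 * (m / lambda).
have q1 : 1 < q by rewrite ltrDl mulr_gt0// divr_gt0.
have q0 : 0 < q := lt_trans ltr01 q1.
pose a : R := Num.sqrt q^-1.
have a2 : a ^+ 2 = q^-1 by rewrite sqr_sqrtr// invr_ge0 ltW.
have a0 : 0 < a by rewrite sqrtr_gt0 invr_gt0.
have a1 : a < 1 by rewrite -sqrtr1 ltr_sqrt ?invf_lt1.
(* The averages are later used at t = s / a, so that t a = s; this is the resulting factor a^-lambda
   of t^lambda. *)
have aV : a^-1 `^ lambda = q `^ (lambda / 2).
  rewrite -[in RHS](invrK q) -a2 -exprVn -powR_mulrn ?invr_ge0 ?(ltW a0)//.
  by rewrite -powRrM; congr (_ `^ _); field.
pose b : R := 1 + 1 / 2 * (lambda / m).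
have b0 : 0 < b by rewrite addr_gt0// mulr_gt0// divr_gt0.
have bE : 1 - a ^+ 2 = b^-1.
  rewrite a2 /q /b; field.
  by rewrite !gt_eqF//= ?addr_gt0// ?mulr_gt0//.
pose C : R := 2 * m * b ^+ k.+1 * q `^ (lambda / 2).
have S_le (s : R) : 0 <= s -> (S s <= (C * s `^ lambda)%:E)%E.
  move=> s0.
  have sa0 : 0 <= s / a by rewrite divr_ge0// ltW.
  have := @growth_from_averages R S k a (s / a) _ S_ge0 S_incr
    (ltW a0) a1 sa0 (S_bound _ sa0).
  rewrite divfK ?gt_eqF// bE exprVn -/m powRM ?invr_ge0 ?(ltW a0)// aV.
  (* Dividing by (1 - a^2)^m / (2 m) = b^-m / (2 m) produces the factor 2 m b^m of [C]. *)
  rewrite -lee_pdivlMr ?divr_gt0 ?invr_gt0 ?exprn_gt0 ?mulr_gt0//.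
  rewrite -EFinM; congr (_ <= _%:E)%E; rewrite /C.
  by field; rewrite !gt_eqF// exprn_gt0.
apply: (@le_trans _ _ (\int[@lebesgue_measure R]_(t in `[0%R, +oo[)
    (C%:E * (weighted_powR R lambda t)%:E))%E).
  have w0 (t : R) : 0 <= t `^ (2 * lambda - 1) / (1 + t `^ (2 * lambda)) ^+ 2.
    by rewrite divr_ge0 ?powR_ge0 ?sqr_ge0.
  apply: le_integral_nonneg => t /=; rewrite in_itv/= andbT => t0.
    by rewrite mule_ge0 ?S_ge0// lee_fin.
  rewrite /weighted_powR [X in (_ <= _ * X)%E]EFinM muleA -(EFinM C).
  by apply: lee_wpmul2r; [rewrite lee_fin | exact: S_le].
have C0 : 0 < C by rewrite !mulr_gt0 ?exprn_gt0 ?powR_gt0.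
rewrite ge0_integralZl//; first last.
- by rewrite lee_fin ltW.
- by move=> t _; rewrite lee_fin weighted_powR_ge0.
- by apply/measurable_EFinP; apply: measurable_funTS; exact: measurable_weighted_powR.
apply: (@le_trans _ _ (C%:E * (pi / 4 / lambda)%:E)%E).
  by apply: lee_wpmul2l; [rewrite lee_fin ltW | exact: integral_weighted_powR_le].
(* The two sides are equal, since 2 m * pi / (4 lambda) = pi / 2 * (m / lambda). *)
rewrite -EFinM lee_fin le_eqVlt; apply/orP; left; apply/eqP.
rewrite -/b -/q /C; field.
by rewrite gt_eqF.
Qed.
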